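(* Let $\Gamma^1=(G,\sigma_1,\mu_1)$ be a $\gamma_1$-regular signed graph on $n_1$ vertices and $m_1$ edges, let $\theta$ be any $r$-orientation of the edges of $\Gamma^1$, and let $\Gamma^2=(H,\sigma_2,\mu_2)$ be any signed graph on $n_2$ vertices and $m_2$ edges. Let $\lambda_1(Q(\Gamma^1)),\dots,\lambda_{n_1}(Q(\Gamma^1))$ be the eigenvalues of $Q(\Gamma^1)$. If $\lambda$ is not a pole of $\Sigma_{Q(\Gamma^2)}(\lambda-2)$, then $$f_{Q((\Gamma^1\diamond\Gamma^2)_\theta)}(\lambda)=\big(f_{Q(\Gamma^2)}(\lambda-2)\big)^{m_1}\prod_{j=1}^{n_1}\Big[(\lambda-\gamma_1n_2)-\big(1+\Sigma_{Q(\Gamma^2)}(\lambda-2)\big)\lambda_j(Q(\Gamma^1))\Big].$$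
   Context: A signed graph $\Gamma=(G,\sigma,\mu)$ has a finite simple graph $G$ with vertices $v_1,\dots,v_n$, signature $\sigma:E(G)\to\{\pm1\}$ and marking $\mu:V(G)\to\{\pm1\}$; $\mu(\Gamma)=(\mu(v_1),\dots,\mu(v_n))^T$. $A(\Gamma)$ has $(i,j)$ entry $\sigma(v_iv_j)$ if $v_i\sim v_j$ and $0$ otherwise; $D(\Gamma)$ is the diagonal matrix of (unsigned) vertex degrees; the signless Laplacian is $Q(\Gamma)=D(\Gamma)+A(\Gamma)$. $\gamma$-regular means all degrees equal $\gamma$. $f_M(\lambda)=\det(\lambda I-M)$. The signed $N$-coronal of a matrix $N$ associated with $\Gamma$ is the rational function $\Sigma_N(X)=\mu(\Gamma)^T(XI_n-N)^{-1}\mu(\Gamma)$. An $r$-orientation of $(G,\sigma)$ is a map $\theta:V(G)\times E(G)\to\{-1,0,1\}$ with $\theta(w,uv)=0$ for $w\notin\{u,v\}$, $\theta(u,uv)\in\{\pm1\}$ at endpoints, and $\theta(u,uv)\theta(v,uv)=\sigma(uv)$. The edge corona $(\Gamma^1\diamond\Gamma^2)_\theta$ (with $E(\Gamma^1)=\{e_1,\dots,e_{m_1}\}$) is obtained from $\Gamma^1$ and $m_1$ disjoint copies of $\Gamma^2$ by joining, for each $t$, both endpoints $u$ of $e_t$ to every vertex $w$ of the $t$-th copy, the edge $uw$ having sign $\theta(u,e_t)\mu_2(w)$, where $\mu_2(w)$ is the marking of the vertex of $\Gamma^2$ corresponding to $w$. *)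

(* Defs.v *)
From HB Require Import structures.
From mathcomp Require Import all_boot all_order all_algebra.

Set Implicit Arguments.
Unset Strict Implicit.
Unset Printing Implicit Defensive.

Import Order.TTheory GRing.Theory Num.Theory.
Local Open Scope ring_scope.

Local Notation "x %:F" := (@FracField.tofrac _ x).

Definition is_sign (x : int) : bool := (x == 1) || (x == -1).

Lemma is_signM (x y : int) : is_sign x -> is_sign y -> is_sign (x * y).
Proof. by move=> /orP[]/eqP-> /orP[]/eqP->. Qed.

(* [sg_sigma] is only meaningful on adjacent pairs: its values on non-adjacent
   pairs are unconstrained and never used. *)
Record signed_graph (V : finType) := SignedGraph {
  sg_adj : rel V;
  sg_sigma : V -> V -> int;
  sg_mu : V -> int;
  sg_adj_sym : symmetric sg_adj;
  sg_adj_irr : irreflexive sg_adj;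
  sg_sigma_sym : forall u v, sg_adj u v -> sg_sigma u v = sg_sigma v u;
  sg_sigma_sign : forall u v, sg_adj u v -> is_sign (sg_sigma u v);
  sg_mu_sign : forall v, is_sign (sg_mu v)
}.

Section Graph.
Variables (V : finType) (G : signed_graph V).

Definition edge_set : {set {set V}} :=
  [set [set uv.1; uv.2] | uv in [set uv : V * V | sg_adj G uv.1 uv.2]].

Definition edge : finType := {e : {set V} | e \in edge_set}.

Definition degree (v : V) : nat := #|[set w | sg_adj G v w]|.

Definition regular (g : nat) : Prop := forall v, degree v = g.

Record r_orientation := ROrientation {
  ro_fun :> V -> edge -> int;
  ro_out : forall w (e : edge), w \notin val e -> ro_fun w e = 0;
  ro_in : forall u (e : edge), u \in val e -> is_sign (ro_fun u e);
  ro_sigma : forall u v (e : edge), val e = [set u; v] ->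
    ro_fun u e * ro_fun v e = sg_sigma G u v
}.

End Graph.

(* Matrices are indexed by 'I_#|V|, the i-th vertex being [enum_val i]. *)
Section Matrices.
Variables (C : fieldType) (V : finType) (G : signed_graph V).

Definition marking_vec : 'cV[C]_#|V| := \col_i (sg_mu G (enum_val i))%:~R.

Definition adj_mx : 'M[C]_#|V| :=
  \matrix_(i, j) if sg_adj G (enum_val i) (enum_val j)
                 then (sg_sigma G (enum_val i) (enum_val j))%:~R else 0.

Definition degree_mx : 'M[C]_#|V| :=
  diag_mx (\row_i (degree G (enum_val i))%:R).

Definition signless_laplacian : 'M[C]_#|V| := degree_mx + adj_mx.

(* [char_poly_mx N] is the polynomial matrix X I - N, inverted over the field
   of rational functions. *)
Definition coronal (N : 'M[C]_#|V|) : {fraction {poly C}} :=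
  let mu := map_mx (fun c : C => (c%:P)%:F) marking_vec in
  (mu^T *m invmx (map_mx (@FracField.tofrac _) (char_poly_mx N)) *m mu)
    0 0.

End Matrices.

Definition charfun (C : fieldType) (n : nat) (M : 'M[C]_n) (x : C) : C :=
  \det (x%:M - M).

(* Poles and values of a rational function are those of its expression in
   lowest terms, so removable singularities are not poles. *)
Section RationalFunctions.
Variable C : fieldType.
Implicit Types (f : {fraction {poly C}}) (x : C).
Local Open Scope quotient_scope.

Definition rat_num f : {poly C} :=
  \n_(repr f) %/ gcdp \n_(repr f) \d_(repr f).

Definition rat_den f : {poly C} :=
  \d_(repr f) %/ gcdp \n_(repr f) \d_(repr f).

Definition is_pole f x : bool := root (rat_den f) x.

Definition rat_eval f x : C := (rat_num f).[x] / (rat_den f).[x].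

Lemma rat_coprime f : coprimep (rat_num f) (rat_den f).
Proof.
apply: coprimep_div_gcd; apply/orP; right; exact: denom_ratioP.
Qed.

Lemma rat_den_neq0 f : rat_den f != 0.
Proof.
rewrite /rat_den dvdp_div_eq0 ?dvdp_gcdr //; exact: denom_ratioP.
Qed.

Lemma rat_numdenE f : f = (rat_num f)%:F / (rat_den f)%:F.
Proof.
have d0 : (rat_den f)%:F != 0 by rewrite tofrac_eq0 rat_den_neq0.
apply: (canRL (mulfK d0)).
have r0 : (\d_(repr f))%:F != 0 by rewrite tofrac_eq0 denom_ratioP.
have fE : f * (\d_(repr f))%:F = (\n_(repr f))%:F.
  rewrite -{1}[f]reprK !piE; apply/eqP; rewrite equivf_def /=.
  rewrite !numden_Ratio ?mulf_neq0 ?oner_neq0 ?denom_ratioP //.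
  by rewrite !mulr1 mulrC.
have g0 : (gcdp \n_(repr f) \d_(repr f))%:F != 0.
  by rewrite tofrac_eq0 gcdp_eq0 negb_and denom_ratioP orbT.
apply: (mulIf g0); rewrite -mulrA -!tofracM.
by rewrite /rat_num /rat_den !divpK ?dvdp_gcdl ?dvdp_gcdr.
Qed.

End RationalFunctions.

Section EdgeCorona.
Variables (V1 V2 : finType) (G1 : signed_graph V1) (G2 : signed_graph V2).
Variable theta : r_orientation G1.

(* [inr (e, w)] is the vertex w in the copy of G2 attached to the edge e. *)
Definition corona_vertex : finType := (V1 + edge G1 * V2)%type.

Definition corona_adj (x y : corona_vertex) : bool :=
  match x, y with
  | inl u, inl v => sg_adj G1 u v
  | inl u, inr (e, _) => u \in val e
  | inr (e, _), inl u => u \in val e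
  | inr (e, w), inr (e', w') => (e == e') && sg_adj G2 w w'
  end.

Definition corona_sigma (x y : corona_vertex) : int :=
  match x, y with
  | inl u, inl v => sg_sigma G1 u v
  | inl u, inr (e, w) => theta u e * sg_mu G2 w
  | inr (e, w), inl u => theta u e * sg_mu G2 w
  | inr (_, w), inr (_, w') => sg_sigma G2 w w'
  end.

Definition corona_mu (x : corona_vertex) : int :=
  match x with
  | inl u => sg_mu G1 u
  | inr (_, w) => sg_mu G2 w
  end.

Lemma corona_adj_sym : symmetric corona_adj.
Proof.
by move=> [u|[e w]] [v|[e' w']] //=; rewrite sg_adj_sym // [e == e']eq_sym.
Qed.

Lemma corona_adj_irr : irreflexive corona_adj.
Proof. by move=> [u|[e w]] /=; rewrite sg_adj_irr ?andbF. Qed.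

Lemma corona_sigma_sym x y :
  corona_adj x y -> corona_sigma x y = corona_sigma y x.
Proof.
case: x y => [u|[e w]] [v|[e' w']] //=; first exact: sg_sigma_sym.
by case/andP=> _; exact: sg_sigma_sym.
Qed.

Lemma corona_sigma_sign x y : corona_adj x y -> is_sign (corona_sigma x y).
Proof.
case: x y => [u|[e w]] [v|[e' w']] /=; first exact: sg_sigma_sign.
- by move=> ue; apply: is_signM; [exact: ro_in | exact: sg_mu_sign].
- by move=> ue; apply: is_signM; [exact: ro_in | exact: sg_mu_sign].
- by case/andP=> _; exact: sg_sigma_sign.
Qed.

Lemma corona_mu_sign x : is_sign (corona_mu x).
Proof. by case: x => [u|[e w]] /=; exact: sg_mu_sign. Qed.

Definition edge_corona : signed_graph corona_vertex :=
  SignedGraph corona_adj_sym corona_adj_irr corona_sigma_sym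
    corona_sigma_sign corona_mu_sign.

End EdgeCorona.

(* Main.v *)
(** With R the incidence matrix of theta, R R^T = Q(G1). Ordering the vertices
    of the corona as V1 followed by E(G1) x V2, and writing mu for the marking of
    G2, regularity gives at x = z + 2 the block form
      [[ z + 2 - gamma n2 - Q(G1), -(R (x) mu^T) ],
       [ -(R (x) mu^T)^T,          I (x) (z - Q(G2)) ]],
    and the Schur complement of the lower right block replaces the upper left
    one by z + 2 - gamma n2 - (1 + Sigma(z)) Q(G1). The block is singular when z
    is an eigenvalue of Q(G2), even where Sigma has no pole; so the computation
    is done over the field of rational functions at z = X, and the denominator
    of Sigma is cleared before specializing X to x - 2. *)
Require Import Defs.
From HB Require Import structures.
From mathcomp Require Import all_boot all_order all_algebra all_fingroup.
From mathcomp Require Import mxtens ring.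

Set Implicit Arguments.
Unset Strict Implicit.
Unset Printing Implicit Defensive.

Import Order.TTheory GRing.Theory Num.Theory.
Local Open Scope ring_scope.

Local Notation "x %:F" := (@FracField.tofrac _ x).

(** * Determinant identities *)

Lemma det_mxsub_bij (R : comNzRingType) m n (h : 'I_m -> 'I_n) (A : 'M[R]_n) :
  bijective h -> \det (mxsub h h A) = \det A.
Proof.
move=> bij_h.
have eq_mn : m = n by have := bij_eq_card bij_h; rewrite !card_ord.
case: n / eq_mn in h A bij_h *; pose s := perm (bij_inj bij_h).
have -> : mxsub h h A = row_perm s (col_perm s A).
  by apply/matrixP=> i j; rewrite !mxE !permE.
rewrite row_permE col_permE !det_mulmx !det_perm odd_permV mulrCA.
by rewrite -signr_addb addbb mulr1.
Qed.

(** A block upper triangular factor times a block lower triangular one. The inverse of [D] is an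
    explicit argument, so that a Kronecker product can be supplied for it. *)
Lemma det_schur (F : fieldType) m n (A : 'M[F]_m) (B : 'M_(m, n))
    (C : 'M_(n, m)) (D D' : 'M_n) :
  D *m D' = 1%:M ->
  \det (block_mx A B C D) = \det D * \det (A - B *m D' *m C).
Proof.
move=> DD'; have D'D := mulmx1C DD'.
have -> : block_mx A B C D =
    block_mx (A - B *m D' *m C) (B *m D') 0 1%:M *m block_mx 1%:M 0 C D.
  rewrite mulmx_block !mulmx1 !mul0mx !mulmx0 !mul1mx !add0r subrK -mulmxA D'D.
  by rewrite mulmx1.
by rewrite det_mulmx det_ublock det_lblock !det1 mulr1 mul1r mulrC.
Qed.

Lemma det_castmx (R : comNzRingType) m n (eq_mn : (m = n) * (m = n))
    (A : 'M[R]_m) : \det (castmx eq_mn A) = \det A.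
Proof.
by case: eq_mn => eq1; case: n / eq1 => eq2; rewrite castmx_id.
Qed.

Lemma det_tens1mx (R : comNzRingType) m n (A : 'M[R]_n) :
  \det ((1%:M : 'M_m) *t A) = \det A ^+ m.
Proof.
elim: m => [|m IHm]; first by rewrite expr0 /=; exact: det_mx00.
rewrite -[m.+1]add1n scalar_mx_block tens_block_mx.
by rewrite det_castmx !tens0mx det_ublock IHm tens_scalar1mx det_castmx exprS.
Qed.

(** For nonzero [b] the determinant is [b ^+ n] times the characteristic polynomial at [a / b]; for
    [b = 0] both sides are [a ^+ n]. *)
Lemma det_scalar_sub_scale (F : fieldType) n (A : 'M[F]_n) (lam : 'I_n -> F)
    (a b : F) :
  char_poly A = \prod_(j < n) ('X - (lam j)%:P) ->
  \det (a%:M - b *: A) = \prod_(j < n) (a - b * lam j).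
Proof.
move=> defA.
have expE (c : F) : c ^+ n = \prod_(j < n) c by rewrite prodr_const card_ord.
have [-> | b_neq0] := eqVneq b 0.
  rewrite scale0r subr0 det_scalar expE.
  by apply: eq_bigr => j _; rewrite mul0r subr0.
have -> : a%:M - b *: A = b *: ((a / b)%:M - A).
  by rewrite scalerBr scale_scalar_mx mulrC divfK.
rewrite detZ; have <- : (char_poly A).[a / b] = \det ((a / b)%:M - A).
  rewrite -[LHS]/(horner_eval _ _) -det_map_mx; congr (\det _).
  apply/matrixP=> i j; rewrite !mxE /= /horner_eval !hornerE.
  by rewrite hornerMn hornerX.
rewrite defA horner_prod expE -big_split; apply: eq_bigr => j _.
by rewrite /= hornerXsubC mulrBr [b * (a / b)]mulrC divfK.
Qed.

(** * Edges and the incidence matrix of an r-orientation *)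

Section Incidence.
Variables (V : finType) (G : signed_graph V).

Lemma mem_edge_set (u v : V) : ([set u; v] \in edge_set G) = sg_adj G u v.
Proof.
apply/imsetP/idP => [[[a b]] | adj_uv]; last by exists (u, v); rewrite ?inE.
rewrite inE /= => adj_ab eq_uv.
(* Mutual inclusion of the two pairs, with [a != b], leaves only (u, v) = (a, b) or (b, a). *)
have := set21 u v; rewrite eq_uv => /set2P u_ab.
have := set22 u v; rewrite eq_uv => /set2P v_ab.
have := set21 a b; rewrite -eq_uv => /set2P a_uv.
have := set22 a b; rewrite -eq_uv => /set2P b_uv.
have nab : a != b by apply: contraTneq adj_ab => ->; rewrite sg_adj_irr.
case: u_ab v_ab => -> [] -> // in a_uv b_uv *.
- by case: b_uv => eq_b; rewrite eq_b eqxx in nab.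
- by rewrite sg_adj_sym.
- by case: a_uv => eq_a; rewrite eq_a eqxx in nab.
Qed.

Lemma edgeP (e : edge G) (u : V) :
  u \in val e -> exists2 v, sg_adj G u v & val e = [set u; v].
Proof.
case: e => /= e /imsetP[[a b]]; rewrite inE /= => adj_ab -> /set2P[]->.
  by exists b.
by exists a; rewrite 1?sg_adj_sym // setUC.
Qed.

Lemma set2_inj (u v w : V) : [set u; v] = [set u; w] -> v = w.
Proof.
move=> eq_uvw.
have := set22 u v; rewrite eq_uvw => /set2P[] // eq_vu.
by have := set22 u w; rewrite -eq_uvw => /set2P[] // ->.
Qed.

Lemma card_edge (e : edge G) : #|val e| = 2%N.
Proof.
case: e => /= e /imsetP[[a b]]; rewrite inE /= => adj_ab ->.
by rewrite cards2; case: eqVneq adj_ab => // ->; rewrite sg_adj_irr.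
Qed.

(** The map from v to {u, v} is a bijection from the neighbours of [u] to the edges at [u]. *)
Lemma card_incident_edges (u : V) :
  #|[set e : edge G | u \in val e]| = degree G u.
Proof.
rewrite /degree -(card_imset _ val_inj).
rewrite -(@card_in_imset _ _ (fun v => [set u; v])); last first.
  by move=> v w _ _ /set2_inj.
apply: eq_card => e; apply/imsetP/imsetP => [[e'] | [v]].
  rewrite inE => /edgeP[v adj_uv ->] ->.
  by exists v; rewrite ?inE.
rewrite inE -mem_edge_set => edge_uv ->.
by exists (exist _ [set u; v] edge_uv); rewrite ?inE ?eqxx.
Qed.

Variable C : fieldType.
Variable theta : r_orientation G.

Definition incidence_mx : 'M[C]_(#|V|, #|edge G|) :=
  \matrix_(i, j) (theta (enum_val i) (enum_val j))%:~R.

(** Only edges containing both [u] and [v] contribute: for [u = v], a square of a sign for each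
    incident edge; otherwise at most the single edge {u, v}. *)
Lemma sum_r_orientation (u v : V) :
  \sum_e theta u e * theta v e =
  if u == v then (degree G u)%:R
  else if sg_adj G u v then sg_sigma G u v else 0.
Proof.
case: eqVneq => [<- | neq_uv].
  rewrite -card_incident_edges -sum1_card natr_sum [RHS]big_mkcond.
  apply: eq_bigr => e _; rewrite inE; case: ifPn => u_e.
    by case/orP: (ro_in theta u_e) => /eqP->.
  by rewrite (ro_out theta u_e) mul0r.
have theta0 (e : edge G) : val e != [set u; v] -> theta u e * theta v e = 0.
  move=> neq_e; have [u_e|u_e] := boolP (u \in val e); last first.
    by rewrite (ro_out theta u_e) mul0r.
  have [v_e|v_e] := boolP (v \in val e); last first.
    by rewrite (ro_out theta v_e) mulr0.
  have [w _ eq_e] := edgeP u_e; move: v_e neq_e; rewrite eq_e.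
  by case/set2P=> eq_v; rewrite eq_v eqxx in neq_uv *.
case: ifPn => [adj_uv | nadj_uv].
  have edge_uv : [set u; v] \in edge_set G by rewrite mem_edge_set.
  rewrite (bigD1 (exist _ [set u; v] edge_uv : edge G)) //= big1 ?addr0.
    by exact: ro_sigma.
  by move=> e neq_e; apply: theta0; rewrite -val_eqE in neq_e.
apply: big1 => e _; apply: theta0.
by apply: contraNneq nadj_uv => eq_e; rewrite -mem_edge_set -eq_e (valP e).
Qed.

Lemma incidence_mx_gram :
  incidence_mx *m incidence_mx^T = signless_laplacian C G.
Proof.
apply/matrixP=> i j; rewrite !mxE.
transitivity ((\sum_e theta (enum_val i) e * theta (enum_val j) e)%:~R : C).
  rewrite (reindex _ (onW_bij _ (@enum_val_bij (edge G)))) rmorph_sum /=.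
  by apply: eq_bigr => k _; rewrite !mxE rmorphM.
rewrite sum_r_orientation (inj_eq enum_val_inj).
case: eqVneq => [<- | _]; first by rewrite sg_adj_irr addr0 mulr1n mulrz_nat.
by rewrite mulr0n add0r; case: ifP.
Qed.

End Incidence.

(** * Degrees and block form of the corona *)

Lemma card_set_sum (T : finType) (P : pred T) :
  #|[set x | P x]| = (\sum_x P x)%N.
Proof.
by rewrite -sum1dep_card big_mkcond; apply: eq_bigr => x _; case: (P x).
Qed.

Section CoronaLaplacian.
Variables (V1 V2 : finType) (G1 : signed_graph V1) (G2 : signed_graph V2).
Variable theta : r_orientation G1.

Lemma degree_corona_inl (u : V1) :
  degree (edge_corona G2 theta) (inl u) = (degree G1 u * #|V2|.+1)%N.
Proof.
rewrite mulnS {1}/degree card_set_sum big_sumType /=.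
congr (_ + _)%N; first by rewrite /degree card_set_sum.
transitivity (\sum_(e : edge G1) \sum_(w : V2) (u \in val e))%N.
  by rewrite pair_bigA; apply: eq_bigr => [[e w]].
rewrite -card_incident_edges card_set_sum big_distrl.
by apply: eq_bigr => e _; rewrite sum_nat_const mulnC.
Qed.

Lemma degree_corona_inr (e : edge G1) (w : V2) :
  degree (edge_corona G2 theta) (inr (e, w)) = (2 + degree G2 w)%N.
Proof.
rewrite -(card_edge e) {1}/degree card_set_sum big_sumType /=.
congr (_ + _)%N.
  by rewrite -sum1_card [RHS]big_mkcond; apply: eq_bigr => u _; case: ifP.
transitivity (\sum_(e' : edge G1) \sum_(w' : V2)
                ((e == e') && sg_adj G2 w w'))%N.
  by rewrite pair_bigA; apply: eq_bigr => [[e' w']].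
rewrite (bigD1 e) //= [X in (_ + X)%N]big1 => [|e'].
  by rewrite addn0 eqxx /degree card_set_sum.
by rewrite eq_sym => /negPf->; rewrite big1.
Qed.

(** This ordering fits [block_mx] and [*t], but need not be the enumeration of [corona_vertex] that
    indexes its Laplacian; composing with [enum_rank] translates between them. *)
Definition corona_index (k : 'I_(#|V1| + #|edge G1| * #|V2|)) :
    corona_vertex V2 G1 :=
  match split k with
  | inl i => inl (enum_val i)
  | inr j => inr (enum_val (mxtens_unindex j).1, enum_val (mxtens_unindex j).2)
  end.

Lemma corona_index_lshift i :
  corona_index (lshift (#|edge G1| * #|V2|) i) = inl (enum_val i).
Proof. by rewrite /corona_index (unsplitK (inl i)). Qed.

Lemma corona_index_rshift e w :
  corona_index (rshift #|V1| (mxtens_index (e, w))) =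
  inr (enum_val e, enum_val w).
Proof.
by rewrite /corona_index (unsplitK (inr (mxtens_index (e, w)))) mxtens_indexK.
Qed.

Lemma corona_index_bij : bijective corona_index.
Proof.
pose g (x : corona_vertex V2 G1) : 'I_(#|V1| + #|edge G1| * #|V2|) :=
  match x with
  | inl u => lshift _ (enum_rank u)
  | inr (e, w) => rshift _ (mxtens_index (enum_rank e, enum_rank w))
  end.
exists g => [k | [u | [e w]]]; rewrite /corona_index /g.
- case: split_ordP => j ->; rewrite !enum_valK //.
  by congr rshift; exact: mxtens_unindexK.
- case: split_ordP => j /eqP; rewrite ?eq_lshift ?eq_lrshift // => /eqP <-.
  by rewrite enum_rankK.
- case: split_ordP => j /eqP; rewrite ?eq_rshift ?eq_rlshift // => /eqP <-.
  by rewrite mxtens_indexK /= !enum_rankK.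
Qed.

Variable F : fieldType.

Local Notation mu := (marking_vec F G2).
Local Notation R := (incidence_mx F theta).
Local Notation Q1 := (signless_laplacian F G1).
Local Notation Q2 := (signless_laplacian F G2).

(** The cast only turns the row dimension [#|V1| * 1] into [#|V1|]. *)
Definition cross_mx : 'M[F]_(#|V1|, #|edge G1| * #|V2|) :=
  castmx (muln1 _, erefl _) (R *t mu^T).

Lemma cross_mxE i j :
  cross_mx i j = R i (mxtens_unindex j).1 * mu (mxtens_unindex j).2 0.
Proof.
rewrite castmxE [LHS]mxE cast_ord_id [mu^T _ _]mxE.
congr (R _ _ * mu _ _); last exact: ord1.
by apply: val_inj; rewrite /= divn1.
Qed.

(** By the mixed product rule this is the Kronecker product of R R^T with a 1 x 1 matrix. *)
Lemma cross_mx_gram (B : 'M[F]_#|V2|) :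
  cross_mx *m (1%:M *t B) *m cross_mx^T =
  (mu^T *m B *m mu) 0 0 *: Q1.
Proof.
rewrite /cross_mx trmx_cast /= trmx_tens trmxK.
have castl m m' n p (eq_m : m = m') (M : 'M[F]_(m, n)) (N : 'M[F]_(n, p)) :
  castmx (eq_m, erefl _) M *m N = castmx (eq_m, erefl _) (M *m N).
  by case: m' / eq_m.
rewrite castl -castmx_mul !tensmx_mul mulmx1 incidence_mx_gram.
rewrite [_ *m mu]mx11_scalar tens_mx_scalar castmx_comp castmx_id.
by rewrite -mx11_scalar.
Qed.

(** A copy vertex gains the two ends of its edge as neighbours, which the shift by 2 absorbs. A
    vertex of [G1] has degree gamma + gamma n2, whose first term belongs to [Q1]. *)
Lemma corona_block (gamma : nat) (z : F) : regular G1 gamma ->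
  mxsub (enum_rank \o corona_index) (enum_rank \o corona_index)
    ((z + 2)%:M - signless_laplacian F (edge_corona G2 theta)) =
  block_mx ((z + 2 - gamma%:R * #|V2|%:R)%:M - Q1) (- cross_mx)
           (- cross_mx^T) (1%:M *t (z%:M - Q2)).
Proof.
move=> reg_G1; rewrite -[LHS]submxK; congr block_mx; apply/matrixP=> i j.
- rewrite !mxE /= (inj_eq enum_rank_inj) !enum_rankK !corona_index_lshift /=.
  rewrite -[inl _ == inl _]/(enum_val i == enum_val j) (inj_eq enum_val_inj).
  rewrite degree_corona_inl !reg_G1.
  case: eqVneq => [<- | _]; last by rewrite !mulr0n.
  by rewrite sg_adj_irr !mulr1n natrM -natr1; ring.
- case: (mxtens_indexP j) => e w; rewrite [RHS]mxE cross_mxE.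
  rewrite mxtens_indexK !mxE /= (inj_eq enum_rank_inj) !enum_rankK.
  rewrite corona_index_lshift corona_index_rshift /= !mulr0n !add0r.
  case: ifPn => [_|not_in]; first by rewrite rmorphM.
  (* Away from the endpoints [theta] vanishes, so the product formula also gives the zero
     entries. *)
  by rewrite (ro_out theta not_in) mul0r.
- case: (mxtens_indexP i) => e w; rewrite [RHS]mxE [cross_mx^T _ _]mxE.
  rewrite cross_mxE mxtens_indexK !mxE /= (inj_eq enum_rank_inj) !enum_rankK.
  rewrite corona_index_lshift corona_index_rshift /= !mulr0n !add0r.
  case: ifPn => [_|not_in]; first by rewrite rmorphM.
  by rewrite (ro_out theta not_in) mul0r.
- case: (mxtens_indexP i) => i1 i2; case: (mxtens_indexP j) => j1 j2.
  rewrite tensmxE !mxE /= (inj_eq enum_rank_inj) !enum_rankK.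
  rewrite !corona_index_rshift /=.
  rewrite -[inr _ == inr _]/((_ == _) && (_ == _)) !(inj_eq enum_val_inj).
  rewrite degree_corona_inr; case: (i1 == j1); last first.
    by rewrite mul0r !mulr0n !add0r oppr0.
  rewrite mul1r /= natrD.
  by case: (i2 == j2); rewrite ?mulr1n ?mulr0n //; ring.
Qed.

Lemma charfun_corona (gamma : nat) (z : F) :
  regular G1 gamma -> z%:M - Q2 \in unitmx ->
  charfun (signless_laplacian F (edge_corona G2 theta)) (z + 2) =
  charfun Q2 z ^+ #|edge G1| *
  \det ((z + 2 - gamma%:R * #|V2|%:R)%:M
    - (1 + (mu^T *m invmx (z%:M - Q2) *m mu) 0 0) *: Q1).
Proof.
move=> reg_G1 unitB; rewrite /charfun.
rewrite -(@det_mxsub_bij _ _ _ (enum_rank \o corona_index)); last first.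
  exact: bij_comp (@enum_rank_bij _) corona_index_bij.
rewrite (corona_block z reg_G1).
rewrite (@det_schur _ _ _ _ _ _ _ (1%:M *t invmx (z%:M - Q2))).
  rewrite det_tens1mx; congr (_ * \det _).
  rewrite mulNmx mulmxN mulNmx opprK cross_mx_gram scalerDl scale1r.
  by rewrite -addrA -opprD.
rewrite tensmx_mul mulmx1 mulmxV //.
(* It remains to see that the Kronecker product of two identity matrices is an identity matrix. *)
apply/matrixP=> i j; case: (mxtens_indexP i) => i1 i2.
case: (mxtens_indexP j) => j1 j2.
rewrite tensmxE !mxE (inj_eq (can_inj (@mxtens_indexK _ _))) xpair_eqE.
by rewrite -natrM mulnb.
Qed.

End CoronaLaplacian.

(** * Passage to rational functions and specialization *)

Lemma map_signless_laplacian (C F : fieldType) (f : {rmorphism C -> F})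
    (V : finType) (G : signed_graph V) :
  map_mx f (signless_laplacian C G) = signless_laplacian F G.
Proof.
apply/matrixP=> i j; rewrite !mxE rmorphD rmorphMn /= rmorph_nat; congr (_ + _).
by case: ifP; rewrite ?rmorph_int ?rmorph0.
Qed.

Section GenericPoint.
Variable C : fieldType.
Implicit Types (p : {poly C}).

Lemma horner_natr k (y : C) : (k%:R : {poly C}).[y] = k%:R.
Proof. by rewrite -polyC_natr hornerC. Qed.

(** With [tofrac_det_char], this reads one polynomial determinant in two ways, at a point of [C] and
    in the fraction field; both maps are ring morphisms and commute with determinants. *)
Lemma horner_det_char n (M : 'M[C]_n) p y :
  (\det (p%:M - map_mx polyC M)).[y] = charfun M p.[y].
Proof.
rewrite -[LHS]/(horner_eval y _) -det_map_mx; congr (\det _).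
by apply/matrixP=> i j; rewrite !mxE /= /horner_eval !hornerE hornerMn.
Qed.

Lemma tofrac_det_char n (M : 'M[C]_n) p :
  (\det (p%:M - map_mx polyC M))%:F =
  charfun (map_mx (@FracField.tofrac _ \o polyC) M) p%:F.
Proof. by rewrite -det_map_mx map_mxB map_scalar_mx -map_mx_comp. Qed.

Variables (V : finType) (G : signed_graph V).
Local Notation FC := {fraction {poly C}}.

Lemma frac_signless_laplacian :
  map_mx (@FracField.tofrac _ \o polyC) (signless_laplacian C G) =
  signless_laplacian FC G.
Proof. exact: map_signless_laplacian. Qed.

(** The determinant is the image of a characteristic polynomial, which is monic and hence
    nonzero. *)
Lemma frac_char_unitmx : ('X%:F)%:M - signless_laplacian FC G \in unitmx.
Proof.
rewrite unitmxE unitfE -[\det _]/(charfun _ _) -frac_signless_laplacian.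
by rewrite -tofrac_det_char tofrac_eq0 monic_neq0 // char_poly_monic.
Qed.

Lemma coronalE :
  coronal G (signless_laplacian C G) =
  ((marking_vec FC G)^T *m invmx (('X%:F)%:M - signless_laplacian FC G)
    *m marking_vec FC G) 0 0.
Proof.
rewrite /coronal -frac_signless_laplacian.
have -> : map_mx (fun c : C => (c%:P)%:F) (marking_vec C G) = marking_vec FC G.
  by apply/matrixP=> i j; rewrite !mxE !rmorph_int.
by rewrite /char_poly_mx map_mxB map_scalar_mx -map_mx_comp.
Qed.

End GenericPoint.

(** An identity between polynomials can be evaluated anywhere, including at eigenvalues of Q(G2). It
    is proved in the fraction field, into which polynomials embed, by [charfun_corona] at z = X. *)
Lemma charfun_corona_poly (C : fieldType) (V1 V2 : finType)
    (G1 : signed_graph V1) (G2 : signed_graph V2) (gamma : nat)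
    (theta : r_orientation G1) (lam : 'I_#|V1| -> C)
    (S := coronal G2 (signless_laplacian C G2)) :
  regular G1 gamma ->
  char_poly (signless_laplacian C G1) = \prod_j ('X - (lam j)%:P) ->
  \det (('X + 2)%:M -
        map_mx polyC (signless_laplacian C (edge_corona G2 theta)))
    * rat_den S ^+ #|V1| =
  \det ('X%:M - map_mx polyC (signless_laplacian C G2)) ^+ #|edge G1| *
  \prod_j (rat_den S * ('X + 2 - gamma%:R * #|V2|%:R)
            - (rat_den S + rat_num S) * (lam j)%:P).
Proof.
move=> reg_G1 lamP; apply/eqP; rewrite -tofrac_eq; apply/eqP.
rewrite !tofracM !tofracXn !tofrac_det_char !frac_signless_laplacian.
rewrite tofracD rmorph_nat (charfun_corona _ reg_G1) ?frac_char_unitmx //.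
rewrite -coronalE -/S -mulrA; congr (_ * _).
have denF_neq0 : (rat_den S)%:F != 0 by rewrite tofrac_eq0 rat_den_neq0.
have denS : S * (rat_den S)%:F = (rat_num S)%:F.
  by rewrite {1}[S]rat_numdenE divfK.
rewrite (det_scalar_sub_scale (lam := fun j => (lam j)%:P%:F)); last first.
  rewrite -frac_signless_laplacian -map_char_poly lamP rmorph_prod.
  by apply: eq_bigr => j _; rewrite rmorphB /= map_polyX map_polyC.
(* The power of the denominator is shared out, one copy to each eigenvalue factor. *)
rewrite rmorph_prod -[in X in _ * X](card_ord #|V1|) -prodr_const -big_split /=.
apply: eq_bigr => j _.
rewrite tofracB !tofracM tofracB !tofracD tofracM !rmorph_nat -denS.
ring.
Qed.

Theorem theorem4p9 (C : numClosedFieldType) (V1 V2 : finType)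
    (G1 : signed_graph V1) (G2 : signed_graph V2)
    (n1 m1 n2 gamma1 : nat)
    (card_V1 : #|V1| = n1) (card_E1 : #|edge G1| = m1) (card_V2 : #|V2| = n2)
    (reg_G1 : regular G1 gamma1) (theta : r_orientation G1)
    (lam : 'I_n1 -> C)
    (lam_eigenvalues : char_poly (signless_laplacian C G1) =
       \prod_(j < n1) ('X - (lam j)%:P))
    (x : C)
    (x_not_pole : ~~ is_pole (coronal G2 (signless_laplacian C G2)) (x - 2)) :
  charfun (signless_laplacian C (edge_corona G2 theta)) x =
    charfun (signless_laplacian C G2) (x - 2) ^+ m1 *
    \prod_(j < n1)
      ((x - gamma1%:R * n2%:R) -
       (1 + rat_eval (coronal G2 (signless_laplacian C G2)) (x - 2)) * lam j).
Proof.
subst n1 m1 n2.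
have := charfun_corona_poly G2 theta reg_G1 lam_eigenvalues.
(* Evaluating X at [x - 2] sends X + 2 to [x]. *)
move/(congr1 (horner^~ (x - 2))); rewrite !hornerM !horner_exp !horner_det_char.
rewrite horner_prod hornerD hornerX horner_natr subrK => key.
move: x_not_pole key; rewrite /is_pole /rat_eval rootE.
set d := (rat_den _).[_]; set n := (rat_num _).[_] => d_neq0 key.
(* Since [x - 2] is not a pole, the reduced denominator is nonzero there and its power cancels. *)
apply: (mulIf (expf_neq0 #|V1| d_neq0)); rewrite {}key -mulrA; congr (_ * _).
have -> : d ^+ #|V1| = \prod_(j < #|V1|) d by rewrite prodr_const card_ord.
rewrite -big_split; apply: eq_bigr => j _ /=.
rewrite !(hornerD, hornerN, hornerM, hornerC, hornerX, horner_natr) -/d -/n.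
by field.
Qed.
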